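(* Let $A$ be an integrally closed local domain with quotient field $L$, let $\widetilde{\mathfrak m}$ be a maximal ideal of the integral closure $I(A)$ of $A$ in the separable-algebraic closure $L^{\mathrm{sep}}$ of $L$, and let $F$ be a finite extension of $L$ contained in the absolute inertia field of $L$ with respect to $\widetilde{\mathfrak m}$. Let $A^*=F\cap I(A)$ be the integral closure of $A$ in $F$ and $B=A^*_{\widetilde{\mathfrak m}\cap A^*}$. Let $\eta\in B$ be an element such that $F=L(\eta)$, the monic minimal polynomial $h(X)$ of $\eta$ over $L$ lies in $A[X]$, and $\eta$ and $h'(\eta)$ are units in $B$. Then $B=A[\eta]_{\mathfrak n}$, where $\mathfrak n=A[\eta]\cap\widetilde{\mathfrak m}$. In particular, for every finite set $Z\subseteq B$ there exists a unit $u$ of $B$ with $u\in A[\eta]$ such that $Z\subseteq A[\eta,1/u]$.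
   Context: The absolute inertia field of $L$ with respect to $\widetilde{\mathfrak m}$ is the subfield of $L^{\mathrm{sep}}$ of all elements fixed by the group $\{\sigma\in\mathrm{Gal}(L^{\mathrm{sep}}|L)\mid \forall x\in I(A):\ x-\sigma(x)\in\widetilde{\mathfrak m}\}$. All rings are regarded as subrings of $L^{\mathrm{sep}}$ and are not assumed Noetherian. *)

(* Defs.v *)
From HB Require Import structures.
From mathcomp Require Import all_boot all_order all_algebra.
From mathcomp Require Import separable.
From mathcomp Require Import boolp classical_sets cardinality.

Set Implicit Arguments.
Unset Strict Implicit.
Unset Printing Implicit Defensive.

Import GRing.Theory.

Local Open Scope ring_scope.
Local Open Scope classical_set_scope.

(* Every ring below is a subset of one ambient field E, which plays the role of
   a separable closure L^sep. *)
Section SubringsOfAField.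
Variable E : fieldType.
Implicit Types (A B I K L F m p R S : set E) (x : E).

Definition subring S := subring_closed [in S].

(* In a field 0^-1 = 0, so closure under all quotients x / y is harmless. *)
Definition subfield K := divring_closed [in K].

Definition adjoin_ring R S := smallest subring (R `|` S).

Definition adjoin_field K S := smallest subfield (K `|` S).

Definition quotient_field A := [set a / b | a in A & b in A `\ 0].

Definition is_unit B x := B x /\ exists2 y, B y & x * y = 1.

Definition is_ideal A I :=
  [/\ I `<=` A, I 0, forall x y, I x -> I y -> I (x + y)
    & forall a x, A a -> I x -> I (a * x)].

Definition maximal_ideal A m :=
  [/\ is_ideal A m, m <> A
    & forall I, is_ideal A I -> m `<=` I -> I = m \/ I = A].

Definition local_ring A := exists! m, maximal_ideal A m.

(* The localization of A at the prime ideal p of A. *)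
Definition localization A p := [set a / s | a in A & s in A `\` p].

Definition integral_closure A : set E :=
  [set x | exists p : {poly E},
     [/\ p \is monic, p \is a polyOver [in A] & root p x]].

Definition integrally_closed A :=
  quotient_field A `&` integral_closure A = A.

Definition minimal_polynomial K x (p : {poly E}) :=
  [/\ p \is monic, p \is a polyOver [in K], root p x
    & forall q : {poly E}, q \is a polyOver [in K] -> q != 0 -> root q x ->
        (size p <= size q)%N].

(* E is a separable-algebraic closure of its subfield L. *)
Definition separable_closure L :=
  [/\ subfield L,
      forall x, exists2 p, minimal_polynomial L x p & separable_poly p
    & forall p : {poly E}, separable_poly p -> (1 < size p)%N ->
        exists x, root p x].

Definition finite_extension L F :=
  [/\ subfield F, L `<=` F
    & exists n (b : 'I_n -> E), (forall i, F (b i)) /\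
        forall x, F x ->
          exists2 c : 'I_n -> E, (forall i, L (c i)) & x = \sum_i c i * b i].

Definition galois_group L : set {rmorphism E -> E} :=
  [set s | bijective s /\ forall x, L x -> s x = x].

Definition absolute_inertia_group A L m : set {rmorphism E -> E} :=
  [set s | galois_group L s /\
           forall x, integral_closure A x -> m (x - s x)].

Definition absolute_inertia_field A L m : set E :=
  [set x | forall s, absolute_inertia_group A L m s -> s x = x].

End SubringsOfAField.

(* Main.v *)
Require Import Defs.
From HB Require Import structures.
From mathcomp Require Import all_boot all_order all_algebra.
From mathcomp Require Import separable.
From mathcomp Require Import boolp classical_sets cardinality.
Set Implicit Arguments.
Unset Strict Implicit.
Unset Printing Implicit Defensive.
Import GRing.Theory.
Local Open Scope ring_scope.
Local Open Scope classical_set_scope.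
(* Let y be an element of F integral over A, and write y = p(eta) with p over L.
   Over L^sep the polynomial h is a product of linear factors X - r.  The sum
   over r of p(r) h/(X - r) is congruent to p h' modulo h and has degree less
   than that of h, so it is the remainder of the division of p h' by h; hence
   its coefficients lie in L.  They are also integral over A, since every r and
   every conjugate p(r) of y is, so they lie in A.  Evaluating at eta gives
   h'(eta) y in A[eta], that is, h'(eta) A^* is contained in A[eta].  As h'(eta)
   is a unit of B, it lies in A[eta] but not in m, so multiplying numerators and
   denominators by h'(eta) turns fractions over A^* into fractions over
   A[eta]. *)

(** * Subrings as ring types: integrality and division with remainder *)

Section SubringType.
Variables (E : fieldType) (S : set E) (S_subring : subring S).

(* The unused proof argument is what the canonical subring structure is
   inferred from, [S] being a mere variable. *)
Definition subring_pred (_ : subring S) : {pred E} := [in S].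

HB.instance Definition _ :=
  GRing.isSubringClosed.Build E (subring_pred S_subring) S_subring.

Record subring_type := SubringType {
  subring_val :> E;
  subring_valP : subring_val \in subring_pred S_subring }.

HB.instance Definition _ := [isSub for subring_val].
HB.instance Definition _ := [Choice of subring_type by <:].
HB.instance Definition _ := [SubChoice_isSubComNzRing of subring_type by <:].

Lemma polyOver_predE (p : {poly E}) :
  (p \is a polyOver [in S]) = (p \is a polyOver (subring_pred S_subring)).
Proof. by []. Qed.

Lemma polyOver_lift (p : {poly E}) : p \is a polyOver [in S] ->
  exists q : {poly subring_type}, p = map_poly val q.
Proof.
move=> Sp; have {}Sp i : p`_i \in subring_pred S_subring by move: i; apply/polyOverP.
exists (\poly_(i < size p) (SubringType (Sp i))).
apply/polyP => i; rewrite coef_map_id0 // coef_poly.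
by case: ltnP => // /leq_sizeP ->.
Qed.

Lemma polyOver_map_val (q : {poly subring_type}) :
  map_poly val q \is a polyOver [in S].
Proof.
apply/(@polyOverP _ (subring_pred S_subring)) => i.
by rewrite coef_map_id0 //; apply: (valP q`_i).
Qed.

(** This form makes [integral_sub] and [integral_mul] available for integral closures given as
    sets. *)
Lemma integral_closureE x :
  integral_closure S x <-> integralOver (val : subring_type -> E) x.
Proof.
split=> [[q [qm /polyOver_lift[p qE] qx]]|[p pm px]].
  exists p; rewrite -?qE //; move: qm; rewrite qE !monicE lead_coef_map_inj ?val_eqE //.
  exact: val_inj.
exists (map_poly val p); split=> //; last exact: polyOver_map_val.
exact: monic_map.
Qed.

Lemma subring_integral_closure : subring (integral_closure S).
Proof.
split=> [|x y|x y]; rewrite !inE ?integral_closureE.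
- exact: integral1.
- exact: integral_sub.
- exact: integral_mul.
Qed.

(** Division by a monic polynomial inverts no coefficient, so it is carried out over the ring type
    of [S] and the result is mapped back to [E]. *)
Lemma monic_division (p h : {poly E}) :
    h \is monic -> h \is a polyOver [in S] -> p \is a polyOver [in S] ->
  exists q r : {poly E}, [/\ q \is a polyOver [in S],
    r \is a polyOver [in S], p = q * h + r & (size r < size h)%N].
Proof.
move=> hm /polyOver_lift[h0 eh] /polyOver_lift[p0 ->].
have h0m : h0 \is monic.
  by move: hm; rewrite eh !monicE lead_coef_map_inj ?val_eqE //; apply: val_inj.
exists (map_poly val (Pdiv.Ring.rdivp p0 h0)).
exists (map_poly val (Pdiv.Ring.rmodp p0 h0)).
split; try exact: polyOver_map_val.
  by rewrite {1}(Pdiv.RingMonic.rdivp_eq h0m p0) rmorphD rmorphM eh.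
rewrite eh !size_map_inj_poly //; try exact: val_inj.
by rewrite Pdiv.Ring.ltn_rmodpN0 // monic_neq0.
Qed.
End SubringType.

(** * Adjunction of an element and minimal polynomials *)

Section Adjunction.
Variable E : fieldType.
Implicit Types (S A L : set E) (p q h : {poly E}) (x y : E).

Lemma subring_adjoin_ring S T : subring (@adjoin_ring E S T).
Proof.
have gen (x : E) : (forall R, subring R -> S `|` T `<=` R -> R x) ->
    adjoin_ring S T x by move=> Rx R [] *; apply: Rx.
split=> [|x y|x y]; rewrite !inE.
- by apply: gen => R [/[!inE]].
- move=> Sx Sy; apply: gen => R Rr SR; case: (Rr) => _ RB _.
  by have := RB x y; rewrite !inE; apply; [apply: Sx | apply: Sy].
- move=> Sx Sy; apply: gen => R Rr SR; case: (Rr) => _ _ RM.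
  by have := RM x y; rewrite !inE; apply; [apply: Sx | apply: Sy].
Qed.

Lemma sub_adjoin_ring S T : S `|` T `<=` @adjoin_ring E S T.
Proof. exact: sub_gen_smallest. Qed.

Lemma adjoin_ring1E S x y : subring S ->
  adjoin_ring S [set x] y <-> exists2 p, p \is a polyOver [in S] & y = p.[x].
Proof.
move=> Sr; split=> [|[p Sp ->]]; last first.
  have Rr := subring_adjoin_ring S [set x].
  have xR : x \in subring_pred Rr by rewrite inE; apply: sub_adjoin_ring; right.
  suffices: p.[x] \in subring_pred Rr by rewrite inE.
  apply: rpred_horner xR; apply: polyOverS Sp => a; rewrite !inE => Sa.
  by apply: sub_adjoin_ring; left.
move: y; apply: smallest_sub => [|y [Sy|->]]; last first.
- by exists 'X; rewrite ?hornerX //; apply: (polyOverX (subring_pred Sr)).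
- exists y%:P; rewrite ?hornerC //.
  by rewrite (polyOverC (subring_pred Sr)) inE.
split=> [|a b|a b]; rewrite !inE.
- by exists 1; rewrite ?hornerC // (polyOver_predE Sr) rpred1.
- move=> [p Sp ->] [q Sq ->].
  by exists (p - q); rewrite ?hornerE // (polyOver_predE Sr) rpredB.
- move=> [p Sp ->] [q Sq ->].
  by exists (p * q); rewrite ?hornerE // (polyOver_predE Sr) rpredM.
Qed.

Lemma minimal_polynomial_dvdp L x h p : subring L ->
    minimal_polynomial L x h -> p \is a polyOver [in L] -> root p x ->
  h %| p.
Proof.
move=> Lr [hm Lh hx hmin] Lp px.
have [q [r [Lq Lr' pE ltrh]]] := monic_division Lr hm Lh Lp.
suffices r0 : r = 0 by rewrite pE r0 addr0 dvdp_mull.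
apply/eqP; apply: contraTT ltrh => r0; rewrite -leqNgt hmin //.
by move: px; rewrite pE !rootE !hornerE (rootP hx) mulr0 add0r.
Qed.

(** For nonzero [x], dividing the minimal polynomial by ['X] leaves a constant [c], nonzero by
    minimality. Hence [x^-1 = - q.[x] / c] is a polynomial expression in [x] over [L]. *)
Lemma subring_inv_algebraic L S x p : subfield L -> subring S -> L `<=` S ->
  minimal_polynomial L x p -> S x -> S x^-1.
Proof.
move=> Lf Sr LS [pm Lp px pmin] Sx.
have Lr : subring L := GRing.divring_closedBM Lf.
have [->|x0] := eqVneq x 0.
  by rewrite invr0; have := rpred0 (subring_pred Sr); rewrite inE.
have [q [r [Lq Lr' pE ltr2]]] := monic_division Lr (monicX E)
  (polyOverX (subring_pred Lr)) Lp.
have {ltr2} /size1_polyC rE : (size r <= 1)%N by rewrite size_polyX in ltr2.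
set c := r`_0 in rE; have p0 := monic_neq0 pm.
have px0 : q.[x] * x + c = 0.
  by move: px; rewrite pE rE rootE !hornerE => /eqP.
(* With [c = 0] the shorter polynomial [q] would already vanish at [x]. *)
have c0 : c != 0.
  apply: contra_eqN (erefl (size p)) => /eqP c0.
  have q0 : q != 0 by apply: contra_neq p0 => q0; rewrite pE rE c0 q0 mul0r addr0.
  have : (size p <= size q)%N.
    apply: pmin => //; move/eqP: px0.
    by rewrite c0 addr0 mulf_eq0 (negPf x0) orbF.
  by rewrite pE rE c0 addr0 size_mulX // ltnn.
have -> : x^-1 = - q.[x] * c^-1.
  have qx : - q.[x] * x = c.
    by rewrite mulNr; apply/eqP; rewrite eqr_oppLR -addr_eq0 px0.
  by rewrite -qx invfM mulrA divff ?mul1r // -(mulIr_eq0 _ (mulIf x0)) qx.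
suffices: - q.[x] * c^-1 \in subring_pred Sr by rewrite inE.
have LS' : {subset [in L] <= subring_pred Sr} by move=> a; rewrite !inE => /LS.
rewrite rpredM ?rpredN //.
  by apply: rpred_horner; rewrite ?inE //; apply: polyOverS Lq.
apply: LS'; have [L1 _ LD] := Lf; rewrite -[c^-1]mul1r; apply: LD => //.
by move: (0%N) @c {rE px0 c0} => i; apply/(@polyOverP _ (subring_pred Lr)).
Qed.

(** Every element is algebraic over [L], so the ring [L[x]] contains the inverses of its elements
    and is a subfield. *)
Lemma adjoin_field1_sub L x : subfield L ->
    (forall y, exists p, minimal_polynomial L y p) ->
  adjoin_field L [set x] `<=` adjoin_ring L [set x].
Proof.
move=> Lf Lalg; have Sr := subring_adjoin_ring L [set x].
apply: smallest_sub; last exact: sub_adjoin_ring.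
have [S1 SB SM] := Sr; split=> // a b aS bS; apply: SM => //.
have [p pb] := Lalg b; move: bS; rewrite !inE => bS.
apply: subring_inv_algebraic pb bS => // y Ly; apply: sub_adjoin_ring; by left.
Qed.

(** * Splitting of separable polynomials and interpolation at their roots *)

Lemma separable_closure_split L p : separable_closure L -> p \is monic ->
  separable_poly p -> exists rs : seq E, p = \prod_(r <- rs) ('X - r%:P).
Proof.
move=> [_ _ closed]; have [n] := ubnP (size p).
elim: n p => // n IHn p; rewrite ltnS => szp pm psep.
have [szp1|szp1] := leqP (size p) 1.
  exists [::]; rewrite big_nil; move: pm; rewrite (size1_polyC szp1).
  by rewrite monicE lead_coefC => /eqP->.
have [r] := closed p psep szp1; rewrite -dvdp_XsubCl => /dvdpP[q pE].
(* The cofactor [q] divides [p], so it inherits separability, and its degree is smaller. *)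
have qm : q \is monic by rewrite -(monicMr _ (monicXsubC r)) -pE.
have [|||rs qE] := IHn q => //.
- by move: szp; rewrite pE size_mul ?polyXsubC_eq0 ?monic_neq0 // size_XsubC addn2.
- by apply: dvdp_separable psep; rewrite pE dvdp_mulr.
by exists (r :: rs); rewrite big_cons -qE mulrC.
Qed.

(* When the [r] are distinct, [g] is the Lagrange interpolation polynomial of
   [p * u^`()], namely the sum over [r] of [p.[r] * u / ('X - r)]. *)
Lemma deriv_interpolation S p (rs : seq E) (u := \prod_(r <- rs) ('X - r%:P)) :
    subring S -> (forall r, r \in rs -> S r /\ S p.[r]) ->
  exists g : {poly E},
    [/\ g \is a polyOver [in S], (size g <= size rs)%N & u %| p * u^`() - g].
Proof.
move=> Sr; rewrite {}/u; elim: rs => [|r rs IHrs] Srs.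
  exists 0; split; rewrite ?size_poly0 ?polyOver0 //.
  by rewrite big_nil derivC mulr0 subr0 dvdp0.
rewrite big_cons; set u := \prod_(s <- rs) _ in IHrs *.
have [|g [Sg szg /dvdpP[k ugk]]] := IHrs.
  by move=> s srs; apply: Srs; rewrite inE srs orbT.
have [Sr' Spr] := Srs r (mem_head _ _).
have /dvdpP[l pl] : 'X - r%:P %| p - p.[r]%:P.
  by rewrite dvdp_XsubCl rootE !hornerE subrr.
(* The new root [r] contributes [p.[r] *: u]; the terms of the other roots gain the factor
   ['X - r%:P]. *)
exists (p.[r] *: u + ('X - r%:P) * g); split.
- rewrite (polyOver_predE Sr) rpredD //.
    apply: (@polyOverZ _ (subring_pred Sr)); rewrite ?inE // /u big_seq.
    apply: rpred_prod => s srs; rewrite polyOverXsubC inE.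
    by have [] := Srs s; rewrite // inE srs orbT.
  by rewrite rpredM // polyOverXsubC inE.
- apply: leq_trans (size_polyD _ _) _; rewrite geq_max.
  rewrite (leq_trans (size_scale_leq _ _)) ?size_prod_XsubC //=.
  apply: leq_trans (size_polyMleq _ _) _; rewrite size_XsubC /=; exact: szg.
(* Both summands on the right are multiples of [('X - r%:P) * u]: the first because ['X - r%:P]
   divides [p - p.[r]%:P], the second by induction. *)
have -> : p * (('X - r%:P) * u)^`() - (p.[r] *: u + ('X - r%:P) * g)
    = (p - p.[r]%:P) * u + ('X - r%:P) * (p * u^`() - g).
  rewrite derivM derivXsubC mul1r -mul_polyC (mulrBl u p).
  by rewrite [_ * (_ - g)]mulrBr addrACA -opprD mulrDr (mulrCA p).
by rewrite pl ugk -mulrA (mulrCA _ k) -mulrDl dvdp_mull.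
Qed.

Lemma sub_quotient_field A : subring A -> A `<=` quotient_field A.
Proof.
case=> + _ _; rewrite inE => A1 a Aa.
by exists a => //; exists 1; rewrite ?divr1 //; split=> //=; apply/eqP/oner_neq0.
Qed.

Lemma deriv_mul_integral_closure A L h x y : subring A -> integrally_closed A ->
    L = quotient_field A -> separable_closure L -> minimal_polynomial L x h ->
    h \is a polyOver [in A] -> adjoin_field L [set x] y ->
    integral_closure A y ->
  adjoin_ring A [set x] (h^`().[x] * y).
Proof.
move=> Ar Aclosed LE Lclosed hmin Ah Fy [g [gm Ag gy]].
have [Lf Lalg _] := Lclosed; have Lr : subring L := GRing.divring_closedBM Lf.
have AL : {subset [in A] <= [in L]}.
  by move=> a; rewrite !inE LE; apply: sub_quotient_field.
have [|p Lp yE] := (adjoin_ring1E x y Lr).1.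
  by apply: adjoin_field1_sub Fy => // z; have [q] := Lalg z; exists q.
have [hm Lh hx _] := hmin.
(* [h] divides the separable polynomial [f], so it is separable itself. *)
have [f fmin fsep] := Lalg x; have [_ Lf' fx _] := fmin.
have hsep := dvdp_separable (minimal_polynomial_dvdp Lr hmin Lf' fx) fsep.
have [rs hE] := separable_closure_split Lclosed hm hsep.
(* Hence for every root [r] of [h] the value [p.[r]] is a root of the monic [g], so it is integral
   over [A]. *)
have gph : h %| g \Po p.
  apply: minimal_polynomial_dvdp hmin _ _ => //.
    by rewrite (polyOver_predE Lr) polyOver_comp //; apply: polyOverS Ag.
  by rewrite rootE horner_comp -yE.
have Ir := subring_integral_closure Ar.
have [r rrs|k [Ik szk]] := deriv_interpolation (p := p) (rs := rs) Ir.
  have hr : root h r by rewrite hE root_prod_XsubC.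
  split; first by exists h.
  exists g; split=> //; rewrite rootE -horner_comp -rootE.
  by rewrite -dvdp_XsubCl (dvdp_trans _ gph) ?dvdp_XsubCl.
rewrite -hE => hk.
have [|q [r [Lq Lr' pE ltrh]]] := monic_division (p := p * h^`()) Lr hm Lh.
  by rewrite (polyOver_predE Lr) rpredM // polyOver_deriv.
(* [h] divides [r - k], whose degree is smaller. The coefficients lie in [L] by the division and are
   integral by the interpolation. *)
have rk : r = k.
  apply/eqP; rewrite -subr_eq0; apply: contraTT hk => rk0.
  rewrite pE -addrA dvdp_addr ?dvdp_mull // gtNdvdp //.
  apply: leq_ltn_trans (size_polyD _ _) _; rewrite size_polyN gtn_max ltrh /=.
  by rewrite hE size_prod_XsubC ltnS.
rewrite adjoin_ring1E //; exists r; last first.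
  by rewrite yE mulrC -hornerM pE !hornerE (rootP hx) mulr0 add0r.
rewrite (polyOver_predE Ar); apply/polyOverP => i; rewrite inE -Aclosed; split.
  suffices: r`_i \in [in L] by rewrite inE LE.
  by move: i; apply/(@polyOverP _ (subring_pred Lr)).
suffices: r`_i \in [in integral_closure A] by rewrite inE.
by rewrite rk; move: i; apply/(@polyOverP _ (subring_pred Ir)).
Qed.

(** * Primality of maximal ideals and common denominators *)

Lemma maximal_ideal_prime R (m : set E) x y : subring R -> maximal_ideal R m ->
  R x -> R y -> m (x * y) -> m x \/ m y.
Proof.
move=> Rr [[mR m0 mD mM] mNR mmax] Rx Ry mxy.
have R1 : R 1 by case: Rr; rewrite inE.
have RD a b : R a -> R b -> R (a + b).
  by have := @rpredD _ (subring_pred Rr) a b; rewrite !inE.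
have RM a b : R a -> R b -> R (a * b).
  by have := @rpredM _ (subring_pred Rr) a b; rewrite !inE.
have R0 : R 0 by apply: mR.
(* If this ideal is [m], it puts [x] in [m]; if it is [R], then [1 = a * x + b], and multiplying by
   [y] puts [y] in [m]. *)
pose I := [set z | exists a b, [/\ R a, m b & z = a * x + b]].
have [|b mb|IE|IE] := mmax I.
- split=> [_ [a [b [Ra mb ->]]]||_ _ [a [b [Ra mb ->]]] [c [d [Rc md ->]]]|].
  + by apply: RD; [apply: RM|apply: mR].
  + by exists 0, 0; rewrite mul0r addr0.
  + exists (a + c), (b + d); split; [exact: RD|exact: mD|].
    by rewrite mulrDl addrACA.
  + move=> c _ Rc [a [b [Ra mb ->]]]; exists (c * a), (c * b).
    by split; [exact: RM|exact: mM|rewrite mulrDr mulrA].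
- by exists 0, b; rewrite mul0r add0r.
- by left; rewrite -IE; exists 1, 0; rewrite mul1r addr0.
- right; have [a [b [Ra mb ab1]]] : I 1 by rewrite IE.
  rewrite -[y]mul1r ab1 mulrDl -mulrA [b * y]mulrC.
  by apply: mD; apply: mM.
Qed.

Lemma localization_common_denominator R (p : set E) (zs : seq E) : subring R -> ~ p 1 ->
    (forall a b, (R `\` p) a -> (R `\` p) b -> ~ p (a * b)) ->
    (forall z, z \in zs -> localization R p z) ->
  exists2 u, (R `\` p) u & forall z, z \in zs -> R (z * u).
Proof.
move=> Rr p1 pM; have [+ _ _] := Rr; rewrite inE => R1.
have RM a b : R a -> R b -> R (a * b).
  by have := @rpredM _ (subring_pred Rr) a b; rewrite !inE.
elim: zs => [|z zs IHzs] pz; first by exists 1.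
have [|u [Ru pu] Rzs] := IHzs.
  by move=> w wzs; apply: pz; rewrite inE wzs orbT.
have [a Ra [s [Rs ps] <-]] := pz z (mem_head _ _).
exists (s * u); first by split; [exact: RM|exact: pM].
move=> w /predU1P[->|wzs]; last by rewrite mulrCA; apply: RM (Rzs _ _).
(* The set [p] may omit 0, so [s] may vanish; the product is then 0. *)
have [s0|s0] := eqVneq s 0.
  by rewrite s0 mul0r mulr0; have := rpred0 (subring_pred Rr); rewrite inE.
by rewrite mulrA divfK //; apply: RM.
Qed.
End Adjunction.

(** * Comparison of the two localizations *)

Theorem theorem1p3 (Lsep : fieldType) (A L m F Astar B n : set Lsep)
    (eta : Lsep) (h : {poly Lsep})
    (A_subring : subring A)
    (A_local : local_ring A)
    (A_closed : integrally_closed A)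
    (L_quotient : L = quotient_field A)
    (Lsep_closure : separable_closure L)
    (m_maximal : maximal_ideal (integral_closure A) m)
    (F_finite : finite_extension L F)
    (F_inertia : F `<=` absolute_inertia_field A L m)
    (Astar_def : Astar = F `&` integral_closure A)
    (B_def : B = localization Astar (m `&` Astar))
    (eta_B : B eta)
    (F_generated : F = adjoin_field L [set eta])
    (h_minimal : minimal_polynomial L eta h)
    (h_A : h \is a polyOver [in A])
    (eta_unit : is_unit B eta)
    (h'_unit : is_unit B h^`().[eta])
    (n_def : n = adjoin_ring A [set eta] `&` m) :
  B = localization (adjoin_ring A [set eta]) n /\
  forall Z : set Lsep, finite_set Z -> Z `<=` B ->
    exists u : Lsep, [/\ is_unit B u, adjoin_ring A [set eta] u
      & Z `<=` adjoin_ring A [set eta; u^-1]].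
Proof.
have Ir := subring_integral_closure A_subring.
have Rr := subring_adjoin_ring A [set eta].
set R := adjoin_ring A [set eta] in n_def Rr *.
have [[mI m0 mD mM] mNI _] := m_maximal.
have [Ff LF _] := F_finite; have [_ _ hx _] := h_minimal.
have hm : h \is monic by case: h_minimal.
have Fr : subring F := GRing.divring_closedBM Ff.
have m1 : ~ m 1.
  move=> m1; apply: mNI; apply/seteqP; split=> // x Ix.
  by rewrite -[x]mulr1; apply: mM.
have RAstar : R `<=` Astar.
  rewrite Astar_def subsetI; split; apply: smallest_sub => // x [Ax|->].
  - by apply: LF; rewrite L_quotient; apply: sub_quotient_field.
  - by rewrite F_generated; apply: sub_gen_smallest; right.
  - apply/(integral_closureE A_subring).
    exact: (integral_id _ (SubringType (mem_set Ax))).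
  - by exists h.
have AstarI : Astar `<=` integral_closure A by rewrite Astar_def => x [].
set d := h^`().[eta] in h'_unit.
have Rd : R d.
  rewrite /R adjoin_ring1E //; exists h^`() => //.
  by rewrite (polyOver_predE A_subring) polyOver_deriv.
(* From [d * (a / s) = 1] follows [a * d = s], so [d] in [m] would put the denominator [s] in
   [m]. *)
have md : ~ m d.
  case: h'_unit => _ [y]; rewrite B_def => -[a Aa [s [As ms] <-]] das mind.
  have [s0|s0] := eqVneq s 0.
    by move/eqP: das; rewrite s0 invr0 !mulr0 eq_sym oner_eq0.
  apply: ms; split=> //; have <- : a * d = s.
    by rewrite -[RHS]mul1r -das mulrA divfK // mulrC.
  by apply: mM => //; apply: AstarI.
have AstarR a : Astar a -> R (d * a).
  rewrite Astar_def => -[Fa Ia].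
  by apply: deriv_mul_integral_closure L_quotient _ _ _ _ _ => //; rewrite -F_generated.
have RmM a b : (R `\` n) a -> (R `\` n) b -> ~ n (a * b).
  rewrite n_def => -[Ra na] [Rb nb] [_ mab].
  have [||ma|mb] := maximal_ideal_prime Ir m_maximal _ _ mab.
  - exact/AstarI/RAstar.
  - exact/AstarI/RAstar.
  - exact: na.
  - exact: nb.
have BE : B = localization R n.
  (* First inclusion: [a / s = (d * a) / (d * s)], where [d * s] stays outside the prime [m]. The
     converse only uses that [R] lies in [Astar]. *)
  rewrite B_def; apply/seteqP; split=> _ [a Aa [s [As ms] <-]].
    exists (d * a); first exact: AstarR.
    exists (d * s).
      split; first exact: AstarR.
      rewrite n_def => -[_ mds].
      have [||//|ms'] := maximal_ideal_prime Ir m_maximal _ _ mds.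
      - exact/AstarI/RAstar.
      - exact/AstarI.
      - exact: ms.
    have d0 : d != 0 by apply: contra_notN md => /eqP->.
    by rewrite invfM mulrACA divff // mul1r.
  exists a; first exact: RAstar.
  exists s => //; split; first exact: RAstar.
  by move=> [mins _]; apply: ms; rewrite n_def.
split=> // Z /finite_seqP[zs ->] ZB.
have n1 : ~ n 1 by rewrite n_def => -[].
have [|u [Ru nu] zsu] := localization_common_denominator (zs := zs) Rr n1 RmM.
  by move=> z zzs; rewrite -BE; apply: ZB.
have R1 : R 1 by case: Rr; rewrite inE.
have u0 : u != 0.
  apply/eqP => u0; apply: nu; rewrite u0 n_def; split=> //.
  by have := rpred0 (subring_pred Rr); rewrite inE.
(* [u] and 1 lie in [R] outside [n], so [u / 1] and [1 / u] are in [B]; each [z] equals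
   [(z * u) / u] with [z * u] in [R]. *)
exists u; split=> //.
  rewrite BE; split; first by exists u => //; exists 1; rewrite ?divr1.
  exists u^-1; rewrite ?divff //.
  by exists 1 => //; exists u => //; rewrite mul1r.
move=> z zzs; have Sr := subring_adjoin_ring A [set eta; u^-1].
have RS : R `<=` adjoin_ring A [set eta; u^-1].
  apply: smallest_sub => // x [Ax|->]; apply: sub_adjoin_ring; first by left.
  by right; left.
rewrite -[z](mulfK u0).
suffices: z * u / u \in subring_pred Sr by rewrite inE.
rewrite rpredM // inE; first by apply: RS; apply: zsu.
by apply: sub_adjoin_ring; right; right.
Qed.
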